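(* There is a cubic platypus of order $n$ if and only if $n$ is even and $n \ge 10$. The smallest cubic platypus is the Petersen graph.
   Context: Graphs are finite and simple, with at least three vertices. A graph is hamiltonian (traceable) if it contains a spanning cycle (spanning path). A platypus is a non-hamiltonian graph $G$ such that for every vertex $v$ of $G$ the vertex-deleted subgraph $G-v$ is traceable. A graph is cubic if all of its vertices have degree $3$. The order of a graph is its number of vertices. *)

(* Defs.v *)
From mathcomp Require Import all_boot.

Set Implicit Arguments.
Unset Strict Implicit.
Unset Printing Implicit Defensive.

Record sgraph := SGraph {
  vertex :> finType;
  adj : rel vertex;
  adj_sym : symmetric adj;
  adj_irrefl : irreflexive adj
}.

(* [ucycle] also holds of [::] and, for every edge xy, of [:: x; y]; the bound
   on [size c] excludes these. *)
Definition hamiltonian (G : sgraph) : Prop :=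
  exists c : seq G,
    [/\ 2 < size c, ucycle (@adj G) c & forall x : G, x \in c].

Definition traceable (G : sgraph) : Prop :=
  exists (x : G) (p : seq G),
    [/\ path (@adj G) x p, uniq (x :: p) & forall y : G, y \in x :: p].

Section InducedSubgraph.
Variables (G : sgraph) (S : {set G}).

Definition induced_adj : rel {x : G | x \in S} :=
  fun x y => adj (val x) (val y).

Lemma induced_adj_sym : symmetric induced_adj.
Proof. by move=> x y; apply: adj_sym. Qed.

Lemma induced_adj_irrefl : irreflexive induced_adj.
Proof. by move=> x; apply: adj_irrefl. Qed.

Definition induced : sgraph := SGraph induced_adj_sym induced_adj_irrefl.

End InducedSubgraph.

Definition delete_vertex (G : sgraph) (v : G) : sgraph := induced [set~ v].

(* The first conjunct is the convention that graphs have at least three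
   vertices; without it the graph with no vertices would qualify. *)
Definition platypus (G : sgraph) : Prop :=
  [/\ 2 < #|G|, ~ hamiltonian G & forall v : G, traceable (delete_vertex v)].

Definition cubic (G : sgraph) : Prop :=
  forall x : G, #|[set y : G | adj x y]| = 3.

Definition isomorphic (G H : sgraph) : Prop :=
  exists2 f : G -> H, bijective f & forall x y : G, adj (f x) (f y) = adj x y.

(* The Petersen graph as the Kneser graph K(5, 2): vertices are the 2-subsets
   of a 5-set, adjacent when disjoint. *)
Definition petersen_vertex : finType := {A : {set 'I_5} | #|A| == 2}.

Definition petersen_adj : rel petersen_vertex :=
  fun A B => [disjoint val A & val B].

Lemma petersen_adj_sym : symmetric petersen_adj.
Proof. by move=> A B; apply: disjoint_sym. Qed.

Lemma petersen_adj_irrefl : irreflexive petersen_adj.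
Proof.
case=> A cardA; rewrite /petersen_adj /= -setI_eq0 setIid.
by apply: contraTF cardA => /eqP ->; rewrite cards0.
Qed.

Definition petersen : sgraph := SGraph petersen_adj_sym petersen_adj_irrefl.

(* Main.v *)
Require Import Defs.
From mathcomp Require Import all_boot.

(** Replacing a vertex v of a cubic graph by a triangle adds two vertices and
    keeps the graph cubic and non-hamiltonian, because a hamiltonian cycle must
    run through the three corners consecutively.  It also keeps both of the
    following: every vertex-deleted subgraph is traceable, and every
    edge-deleted subgraph is traceable.  The second property is what allows
    deleting a corner: a spanning path that avoids the edge from v to the i-th
    neighbor reaches v through the other two corners only.  Starting from the
    Petersen graph this gives all even orders from 10 on.

    Conversely the order is even, and in a cubic platypus of order at most 10 a
    vertex v followed by a spanning path of G - v labels the vertices by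
    0, ..., n - 1 so that i and i + 1 are adjacent for i > 0.  All cubic graphs
    with such a labelling are enumerated: each one is hamiltonian, or has a
    vertex whose deletion leaves a non-traceable graph, or is the Petersen
    graph. *)

Set Implicit Arguments.
Unset Strict Implicit.
Unset Printing Implicit Defensive.

(** * Exhaustive search *)

Section PathSearch.
Variable T : eqType.
Implicit Types (r : rel T) (f : pred T) (x : T) (vs p : seq T).

(** The counter [k] stands for [size vs] and makes the recursion structural, since [rem y vs] is no
    subterm of [vs]; [f] tests the last vertex, which serves to close up cycles. *)
Fixpoint extends r f k x vs : bool :=
  if k is k'.+1 then has (fun y => r x y && extends r f k' y (rem y vs)) vs
  else f x.

Lemma extendsP r f x vs :
  reflect (exists p, [/\ perm_eq p vs, path r x p & f (last x p)])
          (extends r f (size vs) x vs).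
Proof.
move Ek: (size vs) => k; elim: k => [|k IHk] in x vs Ek *.
  move/size0nil: Ek => ->; apply: (iffP idP) => [fx|[p []]].
    by exists [::].
  by move/perm_nilP->.
apply: (iffP hasP) => [[y vs_y /andP[rxy]]|[[|y p] []]].
- have /IHk IH : size (rem y vs) = k by rewrite size_rem // Ek.
  case/IH=> p [eq_p r_p f_p]; exists (y :: p); split=> //=; last by rewrite rxy.
  by rewrite perm_sym (permPl (perm_to_rem vs_y)) perm_cons perm_sym.
- by move/perm_size=> E; rewrite -E in Ek.
move=> eq_p /= /andP[rxy r_p] f_p.
have vs_y : y \in vs by rewrite -(perm_mem eq_p) mem_head.
exists y => //; rewrite rxy /=.
have /IHk IH : size (rem y vs) = k by rewrite size_rem // Ek.
by apply/IH; exists p; rewrite -(perm_cons y) (permPl eq_p) perm_to_rem.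
Qed.

Definition spanning_path r vs :=
  has (fun x => extends r predT (size vs).-1 x (rem x vs)) vs.

Lemma spanning_pathP r vs :
  0 < size vs ->
  reflect (exists2 p, perm_eq p vs & sorted r p) (spanning_path r vs).
Proof.
move=> vs_gt0; apply: (iffP hasP) => [[x vs_x]|[[|x p] eq_p r_p]].
- rewrite -(size_rem vs_x) => /extendsP[p [eq_p r_p _]].
  exists (x :: p) => //.
  by rewrite perm_sym (permPl (perm_to_rem vs_x)) perm_cons perm_sym.
- by rewrite -(perm_size eq_p) in vs_gt0.
have vs_x : x \in vs by rewrite -(perm_mem eq_p) mem_head.
exists x => //; rewrite -(size_rem vs_x); apply/extendsP; exists p; split=> //.
by rewrite -(perm_cons x) (permPl eq_p) perm_to_rem.
Qed.

Definition spanning_cycle r vs :=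
  if vs is x :: vs' then extends r (r^~ x) (size vs') x vs' else true.

(** A closed walk can be rotated, so fixing the first entry of [vs] as the start loses nothing; the
    end test demands the closing edge. *)
Lemma spanning_cycleP r vs :
  reflect (exists2 p, perm_eq p vs & cycle r p) (spanning_cycle r vs).
Proof.
case: vs => [|x vs] /=; first by left; exists [::].
apply: (iffP (extendsP _ _ _ _)) => [[p [eq_p r_p r_px]]|[p eq_p r_p]].
  by exists (x :: p); rewrite /= ?perm_cons // rcons_path r_p.
have p_x : x \in p by rewrite (perm_mem eq_p) mem_head.
have [i q rot_p] := rot_to p_x.
exists q; rewrite -(rot_cycle i) rot_p /= rcons_path in r_p.
have [r_q ?] := andP r_p.
by split=> //; rewrite -(perm_cons x) -rot_p perm_rot.
Qed.

End PathSearch.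

(** * Enumeration of labelled cubic graphs *)

Fixpoint subseqs_of_size (T : Type) k (l : seq T) : seq (seq T) :=
  if k is k'.+1 then
    if l is x :: l' then
      [seq x :: t | t <- subseqs_of_size k' l'] ++ subseqs_of_size k l'
    else [::]
  else [:: [::]].

Lemma filter_subseqs_of_size (T : eqType) (a : pred T) (l : seq T) :
  filter a l \in subseqs_of_size (count a l) l.
Proof.
elim: l => [//|x l IHl] /=; case: (a x) => /=.
  by rewrite mem_cat map_f.
case: (count a l) IHl => [|k] IHl; last by rewrite mem_cat IHl orbT.
suff <- : subseqs_of_size 0 l = [:: [::]] by [].
by case: (l).
Qed.

Section CubicSearch.
Variables (n : nat) (P : seq (seq nat) -> bool).

Definition nbrs (rows : seq (seq nat)) : rel nat :=
  fun i j => j \in nth [::] rows i.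

(* [rows] lists the neighborhoods of the vertices below [i], which determine the
   part [back] of the neighborhood of [i] below [i]; [t] is the part above [i]. *)
Fixpoint all_cubic k (rows : seq (seq nat)) : bool :=
  if k is k'.+1 then
    let i := size rows in
    let back := [seq j <- iota 0 i | nbrs rows j i] in
    (size back <= 3) ==>
    all (fun t => ((0 < i) && (0 < k') ==> (i.+1 \in t)) ==>
                  all_cubic k' (rcons rows (back ++ t)))
        (subseqs_of_size (3 - size back) (iota i.+1 k'))
  else P rows.

Variable a : rel nat.
Hypothesis a_sym : symmetric a.
Hypothesis a_irr : irreflexive a.
Hypothesis a_cubic : forall i, i < n -> count (a i) (iota 0 n) = 3.
Hypothesis a_path : forall i, 0 < i -> i.+1 < n -> a i i.+1.

Definition row i := [seq j <- iota 0 n | a i j].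

(** The search cannot miss [a]: on one branch every chosen row is the true one. Symmetry yields the
    part of a row below the diagonal, irreflexivity the diagonal entry, and the rest is among the
    enumerated subsequences because rows have size 3; [a_path] lets this branch pass the adjacency
    filter. *)
Lemma all_cubicP k i :
  i + k = n -> all_cubic k [seq row j | j <- iota 0 i] ->
  P [seq row j | j <- iota 0 n].
Proof.
elim: k i => [|k IHk] i; first by rewrite addn0 => ->.
rewrite /= size_map size_iota => En.
set back := filter _ _.
have En1 : i.+1 + k = n by rewrite -En addnS.
have lt_in : i < n by rewrite -En1 leq_addr.
have Eback : back = [seq j <- iota 0 i | a i j].
  apply: eq_in_filter => j; rewrite mem_iota /= add0n => lt_ji.
  rewrite /nbrs (nth_map 0) ?size_iota // nth_iota // add0n.
  by rewrite mem_filter mem_iota /= add0n lt_in andbT a_sym.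
have Eiota : iota 0 n = iota 0 i ++ i :: iota i.+1 k.
  by rewrite -En iotaD add0n.
have Erow : row i = back ++ [seq j <- iota i.+1 k | a i j].
  by rewrite /row Eiota filter_cat /= a_irr Eback.
have Ecount := a_cubic lt_in.
rewrite -size_filter -/(row i) Erow size_cat in Ecount.
have le3 : size back <= 3 by rewrite -Ecount leq_addr.
rewrite le3 -Ecount addKn size_filter.
move/allP/(_ _ (filter_subseqs_of_size _ _)).
rewrite -Erow -map_rcons => /implyP H.
apply: (IHk i.+1 En1); rewrite -addn1 iotaD add0n cats1; apply: H.
apply/implyP=> /andP[i_gt0 k_gt0].
rewrite mem_filter mem_iota leqnn /= -[ltnLHS]addn0 ltn_add2l k_gt0 andbT.
by rewrite a_path // -En1 -[i.+2]addn1 leq_add2l.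
Qed.

End CubicSearch.

Section Matching.
Variables (r r' : rel nat) (m : nat).

(** Backtracking for an induced copy of [r] in [r']: [p] lists the images of the labels below
    [size p], and a new image is compared only with earlier ones. *)
Fixpoint embeds k (p : seq nat) : bool :=
  if k is k'.+1 then
    has (fun y => [&& y \notin p,
             all (fun i => r i (size p) == r' (nth 0 p i) y) (iota 0 (size p))
           & embeds k' (rcons p y)]) (iota 0 m)
  else true.

Lemma embedsP k p :
  uniq p -> all (gtn m) p ->
  {in gtn (size p) &, forall i j, i < j -> r i j = r' (nth 0 p i) (nth 0 p j)} ->
  embeds k p ->
  exists q, [/\ size q = size p + k, uniq q, all (gtn m) q
    & {in gtn (size q) &, forall i j, i < j -> r i j = r' (nth 0 q i) (nth 0 q j)}].
Proof.
elim: k p => [|k IHk] p Up lt_p r_p; first by exists p; rewrite addn0.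
case/hasP=> y; rewrite mem_iota add0n /= => lt_y.
case/and3P=> p'y /allP r_y /IHk[]; rewrite ?rcons_uniq ?p'y ?all_rcons /= ?lt_y //.
  move=> i j; rewrite size_rcons !inE !ltnS => le_i le_j lt_ij.
  have lt_ip := leq_trans lt_ij le_j.
  rewrite !nth_rcons lt_ip; move: le_j; rewrite leq_eqVlt => /predU1P[->|lt_j].
    by rewrite ltnn eqxx; apply/eqP/r_y; rewrite mem_iota.
  by rewrite lt_j r_p.
by move=> q; rewrite size_rcons addSnnS; exists q.
Qed.

End Matching.

(** * Searches on labels and the graphs they describe *)

Definition traces (T : eqType) (e : rel T) (A : pred T) : Prop :=
  exists p, [/\ sorted e p, uniq p & p =i A].

(** Paths move between the subtype of vertices other than [v] and sequences over [G]. The order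
    bound makes [G - v] nonempty: the empty sequence traces an empty set, but [traceable] asks for a
    first vertex. *)
Lemma traceable_deleteP (G : sgraph) (v : G) :
  1 < #|G| -> traceable (delete_vertex v) <-> traces (@adj G) (predC1 v).
Proof.
move=> G_gt1; split=> [[x [p [r_p Up in_p]]]|[p [r_p Up in_p]]].
  exists (map val (x :: p)); split; first by rewrite /= path_map.
    by rewrite map_inj_uniq //; apply: val_inj.
  move=> y; apply/mapP/idP => [[z _ ->]|y'v].
    by have := valP z; rewrite !inE.
  have y_v : y \in [set~ v] by rewrite !inE.
  by exists (Sub y y_v).
have /all_sigP[[|x q] Ep] : all (mem [set~ v]) p.
- by apply/allP=> y; rewrite in_p !inE.
- move: G_gt1; rewrite (cardD1 v) inE ltnS => /card_gt0P[y].
  by rewrite !inE andbT => y'v; have := in_p y; rewrite Ep !inE y'v.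
exists x, q; split.
- by move: r_p; rewrite Ep /= path_map.
- by rewrite -(map_inj_uniq val_inj) -Ep.
move=> y; rewrite -(mem_map val_inj) -Ep in_p.
by have := valP y; rewrite !inE.
Qed.

(** Brings a permutation of labels found by a search back to a sequence of vertices. *)
Lemma perm_map_lift (T1 T2 : eqType) (f : T1 -> T2) p t :
  perm_eq p (map f t) -> exists2 q, perm_eq q t & p = map f q.
Proof.
case: t => [|x t]; first by move/perm_nilP->; exists [::].
case/(perm_iotaP (f x)) => I eq_I ->; rewrite size_map in eq_I.
exists (map (nth x (x :: t)) I); last first.
  rewrite -map_comp; apply/eq_in_map=> i; rewrite (perm_mem eq_I) mem_iota => lt_i.
  exact: (nth_map x).
by rewrite -[X in perm_eq _ X](mkseq_nth x) perm_map.
Qed.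

Section Labelling.
Variables (G : sgraph) (s : seq G).
Hypotheses (Us : uniq s) (in_s : forall x, x \in s).
Let lab x := index x s.

Lemma size_labelling : size s = #|G|.
Proof. by rewrite -(card_uniqP Us); apply: eq_card => x; rewrite in_s. Qed.

Lemma lab_inj : injective lab.
Proof. by move=> x y /(congr1 (nth x s)); rewrite !nth_index. Qed.

Lemma map_lab : map lab s = iota 0 (size s).
Proof.
apply: (@eq_from_nth _ 0) => [|i]; rewrite size_map ?size_iota // => lt_i.
have x0 : G by case: (s) lt_i.
by rewrite (nth_map x0) // nth_iota // /lab index_uniq.
Qed.

Lemma card_nbrs (x : G) : #|[set y | adj x y]| = count (adj x) s.
Proof.
rewrite -size_filter -(card_uniqP (filter_uniq _ Us)).
by apply: eq_card => y; rewrite inE mem_filter in_s andbT.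
Qed.

Lemma labelled_path (e : rel G) (r : rel nat) (A : pred G) :
  (forall x y, e x y = r (lab x) (lab y)) -> (exists x, A x) ->
  spanning_path r [seq lab x | x <- s & A x] <-> traces e A.
Proof.
move=> e_r [x0 Ax0].
have sorted_e p : sorted r (map lab p) = sorted e p.
  by rewrite sorted_map; apply: eq_sorted => x y /=; rewrite e_r.
have vs_gt0 : 0 < size [seq lab x | x <- s & A x].
  by rewrite size_map size_filter -has_count; apply/hasP; exists x0.
split=> [/(spanning_pathP r vs_gt0)[_ /perm_map_lift[p eq_p ->]]|].
  rewrite sorted_e => r_p; exists p; split=> //.
    by rewrite (perm_uniq eq_p) filter_uniq.
  by move=> x; rewrite (perm_mem eq_p) mem_filter in_s andbT.
case=> p [r_p Up in_p]; apply/(spanning_pathP r vs_gt0).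
exists (map lab p); last by rewrite sorted_e.
apply/perm_map/uniq_perm => //; first exact: filter_uniq.
by move=> x; rewrite in_p mem_filter in_s andbT.
Qed.

Variable r : rel nat.
Hypothesis adj_r : forall x y : G, adj x y = r (lab x) (lab y).

Lemma labelled_cycle :
  2 < size s -> spanning_cycle r (iota 0 (size s)) <-> hamiltonian G.
Proof.
have cycle_r p : cycle r (map lab p) = cycle (@adj G) p.
  by rewrite cycle_map; apply: eq_cycle => x y /=; rewrite adj_r.
move=> s_gt2; rewrite -map_lab.
split=> [/spanning_cycleP[_ /perm_map_lift[c eq_c ->]]|].
  rewrite cycle_r => r_c; exists c; rewrite (perm_size eq_c) /ucycle r_c.
  by rewrite (perm_uniq eq_c); split=> // x; rewrite (perm_mem eq_c).
case=> c [_ /andP[r_c Uc] in_c]; apply/spanning_cycleP.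
exists (map lab c); rewrite ?cycle_r //.
by apply/perm_map/uniq_perm => // x; rewrite in_c in_s.
Qed.

Definition search_platypus n : bool :=
  ~~ spanning_cycle r (iota 0 n) &&
  all (fun w => spanning_path r [seq i <- iota 0 n | i != w]) (iota 0 n).

Lemma search_platypusP :
  2 < size s -> search_platypus (size s) <-> platypus G.
Proof.
move=> s_gt2; have G_gt2 : 2 < #|G| by rewrite -size_labelling.
have path_w (w : G) :
  spanning_path r [seq i <- iota 0 (size s) | i != lab w]
  <-> traceable (delete_vertex w).
  apply: iff_trans (iff_sym (traceable_deleteP w (ltnW G_gt2))).
  rewrite -map_lab filter_map (@eq_filter _ _ (predC1 w)) => [|x]; last first.
    by rewrite /= (inj_eq lab_inj).
  apply: (labelled_path adj_r).
  have: 0 < #|predC1 w|.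
    by move: G_gt2; rewrite (cardC1 w) -subn1 -ltnS; case: #|G| => [|[]].
  by case/card_gt0P=> x; exists x.
split=> [/andP[/negP c_G /allP p_G]|[_ c_G p_G]].
  split=> // [/(labelled_cycle s_gt2)//|w]; apply/path_w/p_G.
  by rewrite mem_iota index_mem in_s.
apply/andP; split; first by apply/negP=> /(labelled_cycle s_gt2).
apply/allP=> i; rewrite -[X in _ \in X]map_lab => /mapP[w _ ->]; exact/path_w.
Qed.

End Labelling.

(** * The Petersen graph *)

Definition pairs : seq (nat * nat) :=
  [seq (i, j) | i <- iota 0 5, j <- iota i.+1 (4 - i)].

Definition disjoint_pairs (p q : nat * nat) :=
  [&& p.1 != q.1, p.1 != q.2, p.2 != q.1 & p.2 != q.2].

(** The Petersen graph on the labels 0, ..., 9, in terms of numbers only, so that the searches can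
    be evaluated. *)
Definition kneser : rel nat :=
  fun i j => disjoint_pairs (nth (0, 0) pairs i) (nth (0, 0) pairs j).

Lemma kneser_sym : symmetric kneser.
Proof.
move=> i j; rewrite /kneser /disjoint_pairs.
case: (nth _ _ i) (nth _ _ j) => [a b] [c d] /=.
by rewrite !(eq_sym c) !(eq_sym d); do 4 case: (_ == _).
Qed.

Lemma kneser_irr : irreflexive kneser.
Proof. by move=> i; rewrite /kneser /disjoint_pairs eqxx. Qed.

Definition pair_set (p : nat * nat) : {set 'I_5} := [set inord p.1; inord p.2].

Lemma disjoint_pair_set p q : p \in pairs -> q \in pairs ->
  [disjoint pair_set p & pair_set q] = disjoint_pairs p q.
Proof.
have lt5 u : u \in pairs -> u.1 < 5 /\ u.2 < 5.
  suff /allP H : all (fun u => (u.1 < 5) && (u.2 < 5)) pairs by move/H/andP.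
  by [].
case/lt5=> lt_p1 lt_p2 /lt5[lt_q1 lt_q2].
have eqI i j : i < 5 -> j < 5 -> (inord i == inord j :> 'I_5) = (i == j).
  by move=> lt_i lt_j; rewrite -val_eqE /= !inordK.
by rewrite disjoints_subset subUset !sub1set !inE !eqI // !negb_or -!andbA.
Qed.

Lemma petersen_labelling : exists s : seq petersen,
  [/\ uniq s, size s = 10, forall A, A \in s
    & forall A B : petersen, adj A B = kneser (index A s) (index B s)].
Proof.
have card2 : all (fun A : {set 'I_5} => #|A| == 2) (map pair_set pairs).
  apply/allP=> _ /mapP[p pairs_p ->]; rewrite cards2.
  have := disjoint_pair_set pairs_p pairs_p.
  suff /allP/(_ p pairs_p) : all (fun p => (p.1 < 5) && (p.2 < 5) && (p.1 != p.2)) pairs.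
    by case/andP=> /andP[lt1 lt2] neq _; rewrite -val_eqE /= !inordK // neq.
  by [].
have [s Es] : {s : seq petersen | map pair_set pairs = map val s} := all_sigP card2.
have Us : uniq s.
  rewrite -(map_inj_uniq val_inj) -Es map_inj_in_uniq // => p q pairs_p pairs_q Epq.
  (* Equal sets have equal neighborhoods, whereas those of distinct pairs differ. *)
  have twin t : t \in pairs -> disjoint_pairs p t = disjoint_pairs q t.
    by move=> pairs_t; rewrite -!disjoint_pair_set // Epq.
  have: all (fun p => all (fun q =>
     all (fun t => disjoint_pairs p t == disjoint_pairs q t) pairs ==> (p == q)) pairs) pairs.
    by [].
  move/allP/(_ p pairs_p)/allP/(_ q pairs_q)/implyP=> H; apply/eqP/H.
  by apply/allP=> t /twin ->.
have sz_s : size s = 10 by have /(congr1 size) := Es; rewrite !size_map.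
(* Ten distinct vertices are all of them, since ['C(5, 2)] is 10. *)
have in_s A : A \in s.
  have card_P : #|petersen| = 10.
    rewrite card_sig -[10]/'C(5, 2) -[in RHS](card_ord 5) -card_draws.
    by apply: eq_card => B; rewrite !inE.
  have [|_ ->] := uniq_min_size Us (fun B _ => mem_enum predT B).
    by rewrite -cardE card_P sz_s.
  by rewrite mem_enum.
exists s; split=> // A B.
have adjE i j : i < 10 -> j < 10 -> adj (nth A s i) (nth A s j) = kneser i j.
  move=> lt_i lt_j; rewrite /adj /= /petersen_adj.
  rewrite -!(nth_map A (val A)) ?sz_s // -Es.
  by rewrite !(nth_map (0, 0)) // disjoint_pair_set // mem_nth.
by rewrite -adjE -?sz_s ?index_mem // !nth_index.
Qed.

(** Deletes the edge [xy] in both orientations, so that symmetry survives. *)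
Definition avoid (T : eqType) (e : rel T) (x y : T) : rel T :=
  fun a b => e a b && ((a, b) \notin [:: (x, y); (y, x)]).

Lemma cubic_petersen : cubic petersen.
Proof.
have [s [Us sz_s in_s adj_s]] := petersen_labelling => A.
rewrite (card_nbrs Us in_s).
rewrite (eq_count (a2 := preim (index^~ s) (kneser (index A s)))) => [|B]; last first.
  by rewrite adj_s.
rewrite -count_map (map_lab Us) sz_s.
have: all (fun i => count (kneser i) (iota 0 10) == 3) (iota 0 10) by [].
by move/allP=> H; apply/eqP/H; rewrite mem_iota -sz_s index_mem in_s.
Qed.

Lemma search_platypus_kneser : search_platypus kneser 10.
Proof. by lazy. Qed.

(** Base case for edge deletion. For nonadjacent [i] and [j] nothing is deleted and plain
    traceability is tested. *)
Lemma spanning_path_kneser_avoid :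
  all (fun i => all (fun j => spanning_path (avoid kneser i j) (iota 0 10))
                    (iota 0 10)) (iota 0 10).
Proof. by lazy. Qed.

Lemma platypus_petersen : platypus petersen.
Proof.
have [s [Us sz_s in_s adj_s]] := petersen_labelling.
apply/(search_platypusP Us in_s adj_s); first by rewrite sz_s.
by rewrite sz_s search_platypus_kneser.
Qed.

Lemma petersen_avoid (A B : petersen) : traces (avoid (@adj petersen) A B) predT.
Proof.
have [s [Us sz_s in_s adj_s]] := petersen_labelling.
have lt_s C : index C s \in iota 0 10 by rewrite mem_iota -sz_s index_mem in_s.
apply/(labelled_path (r := avoid kneser (index A s) (index B s)) Us in_s).
- move=> C D; rewrite /avoid adj_s !inE !xpair_eqE.
  by rewrite !(inj_eq (lab_inj in_s)).
- by exists A.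
rewrite filter_predT (map_lab Us) sz_s.
by move/allP/(_ _ (lt_s A))/allP/(_ _ (lt_s B)): spanning_path_kneser_avoid.
Qed.

(** * Cubic platypuses of order at most ten *)

Definition search_outcome n (rows : seq (seq nat)) : bool :=
  search_platypus (nbrs rows) n ==>
  (n == 10) && embeds (nbrs rows) kneser 10 n [::].

(* [lazy] rather than [vm_compute], because the search is only feasible when [&&],
   [==>], [has] and [all] are short-circuited. *)
Lemma all_cubic_search n :
  n \in [:: 4; 6; 8; 10] -> all_cubic (search_outcome n) n [::].
Proof.
suff /allP : all (fun n => all_cubic (search_outcome n) n [::]) [:: 4; 6; 8; 10].
  exact.
by lazy.
Qed.

(** Double counting: there are [3 * #|G|] ordered adjacent pairs, and swapping matches the pairs
    increasing in [enum_rank] with the others, so that number is even. *)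
Lemma cubic_order_even (G : sgraph) : cubic G -> ~~ odd #|G|.
Proof.
move=> cubG.
pose E := [set p : G * G | adj p.1 p.2].
pose L := [set p in E | enum_rank p.1 < enum_rank p.2].
have cardE : #|E| = 3 * #|G|.
  rewrite -sum1dep_card -(pair_big_dep predT (@adj G) (fun _ _ => 1)) /=.
  rewrite (eq_bigr (fun=> 3)) => [|x _]; first by rewrite sum_nat_const mulnC.
  by rewrite sum1dep_card cubG.
have swap_inj : injective (fun p : G * G => (p.2, p.1)).
  by move=> [a b] [c d] [-> ->].
have EL : E :\: L = [set (p.2, p.1) | p in L].
  apply/setP=> -[x y]; rewrite !inE /=; apply/andP/imsetP => [[]|[[a b]]].
    rewrite negb_and -leqNgt => /orP[/negP//|le_yx] xy.
    exists (y, x) => //; rewrite !inE /= adj_sym xy ltn_neqAle le_yx andbT.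
    apply: contraTneq xy => /val_inj/enum_rank_inj->; by rewrite adj_irrefl.
  rewrite !inE /= => /andP[ab lt_ab] [-> ->]; rewrite adj_sym ab; split=> //.
  by rewrite -leqNgt ltnW.
have: odd #|E| = false.
  rewrite -(cardsID L E) EL card_imset //.
  have /setIidPr-> : L \subset E by apply/subsetP=> p; rewrite inE => /andP[].
  by rewrite addnn odd_double.
by rewrite cardE oddM /= => ->.
Qed.

Lemma small_cubic_platypus (G : sgraph) : cubic G -> platypus G -> #|G| <= 10 ->
  #|G| = 10 /\ isomorphic G petersen.
Proof.
move=> cubG platG le10.
have [G_gt2 _ pathG] := platG.
have [v _] : exists v : G, v \in G by apply/card_gt0P; apply: leq_trans G_gt2.
have /(traceable_deleteP v (ltnW G_gt2))[p [path_p Up in_p]] := pathG v.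
pose s := v :: p; pose n := size s.
have Us : uniq s by rewrite /= Up in_p !inE eqxx.
have in_s x : x \in s by rewrite inE in_p !inE orbN.
have sz_s : n = #|G| by exact: size_labelling Us in_s.
pose a i j := adj (nth v s i) (nth v s j).
have a_sym : symmetric a by move=> i j; apply: adj_sym.
have a_irr : irreflexive a by move=> i; apply: adj_irrefl.
have a_cubic i : i < n -> count (a i) (iota 0 n) = 3.
  move=> _; rewrite -(cubG (nth v s i)) (card_nbrs Us in_s).
  by rewrite -[X in _ = count _ X](mkseq_nth v) count_map.
have a_path i : 0 < i -> i.+1 < n -> a i i.+1.
  (* Label [i.+1] is position [i] of [p], since [v] has label 0. *)
  by case: i => // i _ lt_i; apply: (elimT (sortedP v) path_p).
have n_in : n \in [:: 4; 6; 8; 10].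
  have := cubic_order_even cubG; move: le10 G_gt2; rewrite -sz_s.
  by clear; do 11 (case: n => [|n] //).
pose r := nbrs [seq row n a i | i <- iota 0 n].
have adj_r x y : adj x y = r (index x s) (index y s).
  have lt_n z : index z s < n by rewrite index_mem in_s.
  rewrite /r /nbrs (nth_map 0) ?size_iota // nth_iota // mem_filter mem_iota.
  by rewrite !add0n lt_n !andbT /a !nth_index.
have rE i j : i < n -> j < n -> r i j = a i j.
  by move=> lt_i lt_j; rewrite /a adj_r !index_uniq.
have out : search_outcome n [seq row n a i | i <- iota 0 n].
  exact: (all_cubicP a_sym a_irr a_cubic a_path (add0n n) (all_cubic_search n_in)).
have : search_platypus r n.
  by apply/(search_platypusP Us in_s adj_r); rewrite // -/n sz_s.
move/(implyP out)/andP=> [/eqP n10]; rewrite -/r n10 => /embedsP[] // q [].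
rewrite add0n => sz_q Uq lt_q r_q.
split; first by rewrite -sz_s.
have [t [Ut sz_t in_t adj_t]] := petersen_labelling.
have [A0 _] : exists A : petersen, A \in t.
  by case: t sz_t {Ut in_t adj_t} => // A t; exists A; rewrite mem_head.
have lab10 x : index x s < 10 by rewrite -n10 index_mem.
have q_lt i : i < 10 -> nth 0 q i < size t.
  by move=> lt_i; rewrite sz_t; apply: (allP lt_q); rewrite mem_nth ?sz_q.
(* [embeds] compares only pairs [i < j]; symmetry and irreflexivity of both relations give the
   others. *)
have r_qE i j : i < 10 -> j < 10 -> r i j = kneser (nth 0 q i) (nth 0 q j).
  move=> lt_i lt_j; case: (ltngtP i j) => [lt_ij|lt_ji|<-].
  - by apply: r_q; rewrite ?inE ?sz_q.
  - by rewrite rE ?n10 // a_sym -rE ?n10 // kneser_sym r_q // ?inE ?sz_q.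
  by rewrite rE ?n10 // a_irr kneser_irr.
(* From a vertex to its label, to the matched label, to the Petersen vertex. Injectivity suffices,
   as both orders are 10. *)
pose f x := nth A0 t (nth 0 q (index x s)).
exists f.
  apply: inj_card_bij; last by rewrite -(size_labelling Ut in_t) sz_t -sz_s n10.
  move=> x y /eqP; rewrite nth_uniq ?q_lt // nth_uniq ?sz_q // => /eqP.
  exact: lab_inj.
by move=> x y; rewrite adj_t !index_uniq ?q_lt // adj_r r_qE.
Qed.

(** * Ends of sequences, rotation of cycles, choices among three indices *)

Definition olink (T : Type) (e : rel T) (x y : option T) : bool :=
  if x is Some x' then if y is Some y' then e x' y' else true else true.

Definition olast (T : Type) (s : seq T) : option T := ohead (rev s).

(** An empty part has no end, and [olink] then imposes no condition. *)
Lemma sorted_cat_olink (T : Type) (e : rel T) s1 s2 :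
  sorted e (s1 ++ s2) =
    [&& sorted e s1, olink e (olast s1) (ohead s2) & sorted e s2].
Proof.
case/lastP: s1 => [|s1 x]; first by [].
rewrite /olast rev_rcons /=; case: s1 => [|y s1] /=.
  by case: s2.
by rewrite cat_path rcons_path last_rcons; case: s2 => [|z s2] //=; rewrite !andbT.
Qed.

Lemma ohead_mem (T : eqType) (s : seq T) x : ohead s = Some x -> x \in s.
Proof. by case: s => //= y s [->]; rewrite mem_head. Qed.

Lemma olast_mem (T : eqType) (s : seq T) x : olast s = Some x -> x \in s.
Proof. by rewrite -mem_rev; apply: ohead_mem. Qed.

Lemma olast_map (T1 T2 : Type) (f : T1 -> T2) s : olast (map f s) = omap f (olast s).
Proof. by rewrite /olast -map_rev; case: (rev s). Qed.

Lemma ohead_map (T1 T2 : Type) (f : T1 -> T2) s : ohead (map f s) = omap f (ohead s).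
Proof. by case: s. Qed.

(** The cycle is rotated so that its seam lies where it enters [P], going from [u] to [y]. *)
Lemma cycle_segment (T : eqType) (e : rel T) (P : pred T) c :
  cycle e c -> has P c -> ~~ all P c ->
  exists y d u, [/\ cycle e (y :: rcons d u), perm_eq (y :: rcons d u) c, P y & ~~ P u].
Proof.
move=> e_c has_P /allPn[x c_x not_Px].
have [i c' rot_c] := rot_to c_x.
have: has P c'.
  by move: has_P; rewrite -(has_rot i) rot_c /= (negPf not_Px).
move=> has_c'; case: (split_find has_c') rot_c => y p1 p2 Py np1 rot_c.
have Erot : rot (size (x :: p1)) (rot i c) = y :: rcons (p2 ++ belast x p1) (last x p1).
  by rewrite rot_c -cat_cons -rcons_cons cat_rcons rot_size_cat rcons_cat -lastI.
exists y, (p2 ++ belast x p1), (last x p1); split=> //.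
- by rewrite -Erot !rot_cycle.
- by rewrite -Erot !perm_rot.
have := mem_last x p1; rewrite inE => /predU1P[->//|].
exact: (hasPn np1).
Qed.

Lemma mem_uniq3 (i j k l : 'I_3) : uniq [:: i; j; k] -> l \in [:: i; j; k].
Proof.
move=> U3; have [|_ ->] := uniq_min_size U3 (fun z _ => mem_enum predT z).
  by rewrite size_enum_ord.
by rewrite mem_enum.
Qed.

Lemma free_index (a b : option 'I_3) : exists m, (a != Some m) && (b != Some m).
Proof.
case: (pickP (fun m => (a != Some m) && (b != Some m))) => [m|none]; first by exists m.
have: size (map Some (enum 'I_3)) <= size [:: a; b].
  apply: uniq_leq_size => [|_ /mapP[m _ ->]].
    by rewrite map_inj_uniq ?enum_uniq //; apply: Some_inj.
  by have := none m; rewrite !inE !(eq_sym (Some m)); do 2 case: eqP.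
by rewrite size_map size_enum_ord.
Qed.

Lemma third_index (i j : 'I_3) : i != j -> exists k, uniq [:: i; j; k].
Proof.
have [k /andP[i'k j'k]] := free_index (Some i) (Some j) => neq_ij; exists k.
rewrite !(inj_eq Some_inj) in i'k j'k.
by rewrite /= !inE negb_or neq_ij i'k j'k.
Qed.

(** [a] and [b] stand for the indices of the edges by which a path arrives at a vertex and leaves
    it, with [None] at an end of the path. Missing indices are filled in so that [i] and [k] are the
    two indices other than [m]. *)
Lemma end_indices (a b : option 'I_3) m : a != Some m -> b != Some m ->
  (a = b -> a = None) ->
  exists i k, [/\ uniq [:: i; m; k], a \in [:: None; Some i] & b \in [:: None; Some k]].
Proof.
case: a b => [i|] [k|] a'm b'm ab.
- exists i, k; split; rewrite ?inE ?eqxx ?orbT //= !inE negb_or.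
  rewrite !(inj_eq Some_inj) in a'm b'm; rewrite a'm (eq_sym m) b'm !andbT.
  by apply/eqP=> E; move: ab; rewrite E => /(_ erefl).
- have [k U] := third_index (a'm : i != m).
  by exists i, k; rewrite !inE eqxx ?orbT.
- have [i U] := third_index (b'm : k != m).
  exists i, k; split; rewrite ?inE ?eqxx ?orbT //.
  by rewrite -(rev_uniq [:: k; m; i]) in U.
have [i i'm] : exists i : 'I_3, i != m.
  by have [i /andP[]] := free_index (Some m) None; exists i; rewrite eq_sym.
by have [k U] := third_index i'm; exists i, k.
Qed.

(** The invariant of the triangle replacement; its third condition supplies the paths needed when a
    corner is deleted. *)
Definition robust (G : sgraph) : Prop :=
  [/\ ~ hamiltonian G,
      forall w : G, traces (@adj G) (predC1 w)
    & forall x y : G, adj x y -> traces (avoid (@adj G) x y) predT].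

Lemma avoidC (T : eqType) (e : rel T) x y : avoid e x y =2 avoid e y x.
Proof. by move=> a b; rewrite /avoid !inE orbC. Qed.

Lemma avoid_sym (T : eqType) (e : rel T) x y : symmetric e -> symmetric (avoid e x y).
Proof.
move=> e_sym a b; rewrite /avoid e_sym !inE !xpair_eqE orbC.
by rewrite ![(a == _) && _]andbC.
Qed.

(** * Replacing a vertex by a triangle *)

Section Triangle.
Variables (G : sgraph) (v : G) (n : 'I_3 -> G).

(* The triangle consists of [inl v] and the two new vertices; [port] sends a
   vertex to its image under contraction of the triangle, together with the index
   of the corner (a dummy index outside the triangle). *)
Definition port (p : G + 'I_2) : G * 'I_3 :=
  match p with
  | inl x => (x, ord0)
  | inr j => (v, lift ord0 j)
  end.

Definition triangle_adj : rel (G + 'I_2) := fun p q =>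
  let: (x, i) := port p in let: (y, j) := port q in
  if x == v then if y == v then i != j else y == n i
  else if y == v then x == n j else adj x y.

Lemma triangle_adj_sym : symmetric triangle_adj.
Proof.
move=> p q; rewrite /triangle_adj; case: (port p) (port q) => x i [y j].
by case: eqP; case: eqP => // _ _; [rewrite eq_sym | apply: adj_sym].
Qed.

Lemma triangle_adj_irrefl : irreflexive triangle_adj.
Proof.
move=> p; rewrite /triangle_adj; case: (port p) => x i.
by rewrite eqxx adj_irrefl; case: eqP.
Qed.

Definition triangle_graph : sgraph := SGraph triangle_adj_sym triangle_adj_irrefl.

Definition corner (i : 'I_3) : G + 'I_2 :=
  if unlift ord0 i is Some j then inr j else inl v.

Lemma port_corner i : port (corner i) = (v, i).
Proof. by rewrite /corner; case: unliftP => [j|] ->. Qed.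

Lemma corner_inj : injective corner.
Proof. by move=> i j /(congr1 port); rewrite !port_corner => -[]. Qed.

Lemma corner_neq x i : x != v -> (inl x == corner i) = false.
Proof.
move=> x'v; apply: contraNF x'v => /eqP/(congr1 port).
by rewrite port_corner => -[->].
Qed.

(** Hides that the corner of index 0 is encoded as [inl v]: case analysis yields corners and old
    vertices other than [v]. *)
Variant vertex_spec : G + 'I_2 -> Type :=
  | Corner i : vertex_spec (corner i)
  | Outer x of x != v : vertex_spec (inl x).

Lemma vertexP p : vertex_spec p.
Proof.
have corner_port q : (port q).1 = v -> corner (port q).2 = q.
  by case: q => [x /= ->|j _]; rewrite /corner /= ?unlift_none ?liftK.
case: p => [x|j]; last by rewrite -(corner_port (inr j)) //; apply: Corner.
have [->|x'v] := eqVneq x v; last exact: Outer.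
by rewrite -(corner_port (inl v)) //; apply: Corner.
Qed.

Lemma adj_corner i j : triangle_adj (corner i) (corner j) = (i != j).
Proof. by rewrite /triangle_adj !port_corner eqxx. Qed.

Lemma adj_corner_outer i x : x != v -> triangle_adj (corner i) (inl x) = (x == n i).
Proof. by move=> x'v; rewrite /triangle_adj port_corner /= eqxx (negPf x'v). Qed.

Lemma adj_outer_corner i x : x != v -> triangle_adj (inl x) (corner i) = (x == n i).
Proof. by move=> x'v; rewrite triangle_adj_sym adj_corner_outer. Qed.

Lemma adj_outer x y : x != v -> y != v -> triangle_adj (inl x) (inl y) = adj x y.
Proof. by move=> x'v y'v; rewrite /triangle_adj /= (negPf x'v) (negPf y'v). Qed.

Lemma card_triangle_graph : #|triangle_graph| = #|G| + 2.
Proof. by rewrite card_sum card_ord. Qed.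

Hypotheses (n_inj : injective n) (adj_v : forall x, adj v x = (x \in codom n)).

Lemma adj_n i : adj v (n i).
Proof. by rewrite adj_v codom_f. Qed.

Lemma n_neq i : n i != v.
Proof. by apply: contraTneq (adj_n i) => ->; rewrite adj_irrefl. Qed.

Lemma card_vertices (F : pred (G + 'I_2)) :
  #|[set p | F p]| = #|[set x | (x != v) && F (inl x)]| + #|[set i | F (corner i)]|.
Proof.
rewrite -(card_imset _ (@inl_inj G 'I_2)) -(card_imset _ corner_inj) -cardsUI.
set O := imset _ _; set C := imset _ _.
have -> : O :&: C = set0.
  apply/setP=> p; rewrite !inE; apply/andP=> -[/imsetP[x + ->] /imsetP[i _ /eqP]].
  by rewrite inE => /andP[x'v _]; rewrite corner_neq.
rewrite cards0 addn0; apply: eq_card => p; rewrite !inE.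
apply/idP/orP => [|[]/imsetP[z + ->]]; last first.
- by rewrite inE.
- by rewrite inE => /andP[].
case: (vertexP p) => [i Fi|x x'v Fx]; [right | left]; apply: imset_f; rewrite inE //.
by rewrite x'v.
Qed.

(** A corner has two corners and one outer vertex as neighbors; an outer vertex adjacent to [v]
    exchanges [v] for exactly one corner. *)
Lemma cubic_triangle_graph : cubic G -> cubic triangle_graph.
Proof.
move=> cubG p; rewrite card_vertices /=.
case: (vertexP p) => [i|x x'v].
  rewrite (_ : [set x | (x != v) && _] = [set n i]) ?cards1.
    rewrite (_ : [set j | _] = [set~ i]) ?cardsC1 ?card_ord //.
    by apply/setP=> j; rewrite !inE adj_corner eq_sym.
  apply/setP=> x; rewrite !inE; have [->|x'v] := eqVneq x v; last first.
    by rewrite adj_corner_outer.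
  by rewrite eq_sym (negPf (n_neq i)).
rewrite -[RHS](cubG x) (cardsD1 v [set y | adj x y]) addnC; congr (_ + _).
  rewrite inE adj_sym adj_v; case: codomP => [[i ->]|x'n].
    rewrite (_ : [set _ | _] = [set i]) ?cards1 //.
    by apply/setP=> j; rewrite !inE adj_outer_corner ?n_neq // (inj_eq n_inj) eq_sym.
  rewrite (_ : [set _ | _] = set0) ?cards0 //; apply/setP=> j.
  rewrite !inE adj_outer_corner //; apply/eqP=> Ex; case: x'n; by exists j.
apply: eq_card => y; rewrite !inE; case: eqVneq => //= y'v; exact: adj_outer.
Qed.

(** Contraction keeps the path. Its first vertex may be a corner, and then the edge leaving the
    triangle becomes an edge from [v] to some [n i]. *)
Lemma path_outer p s : (forall i, corner i \notin s) ->
  path triangle_adj p s -> path (@adj G) (port p).1 [seq (port q).1 | q <- s].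
Proof.
elim: s p => //= q s IHs p out_s /andP[pq path_s].
apply/andP; split.
  move: pq (out_s); case: (vertexP q) => [i _ /(_ i)|y y'v pq _].
    by rewrite mem_head.
  case: (vertexP p) pq => [i|x x'v].
    by rewrite adj_corner_outer // port_corner => /eqP ->; apply: adj_n.
  by rewrite adj_outer.
by apply: IHs => // i; have := out_s i; rewrite inE negb_or => /andP[].
Qed.

(** A hamiltonian cycle is rotated to enter the triangle at [corner i], coming from [n i]. It must
    go on through the other two corners, since each corner has a single outer neighbor, and
    contraction then gives a hamiltonian cycle of [G]. *)
Lemma nonhamiltonian_triangle_graph :
  ~ hamiltonian G -> ~ hamiltonian triangle_graph.
Proof.
move=> nhamG [c [_ /andP[cyc_c Uc] in_c]]; apply: nhamG.
pose P (p : G + 'I_2) := (port p).1 == v.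
have P_corner i : P (corner i) by rewrite /P port_corner eqxx.
have has_P : has P c by apply/hasP; exists (corner ord0).
have not_all : ~~ all P c.
  by apply/allPn; exists (inl (n ord0)) => //; rewrite /P n_neq.
have [p [d [u [cyc_p eq_p Pp not_Pu]]]] := cycle_segment cyc_c has_P not_all.
have Up : uniq (p :: rcons d u) by rewrite (perm_uniq eq_p).
have in_p q : q \in p :: rcons d u by rewrite (perm_mem eq_p).
move=> {c cyc_c Uc in_c has_P not_all eq_p}.
case: (vertexP p) Pp cyc_p Up in_p => [i _|x x'v]; last by rewrite /P /= (negPf x'v).
case: (vertexP u) not_Pu => [j|x x'v _]; first by rewrite P_corner.
rewrite (cycle_path (corner i)) /= last_rcons adj_outer_corner //.
case/andP=> /eqP Ex; rewrite {}Ex in x'v *.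
case: d => [|z d].
  move=> _ _ in_p; have [j /andP[i'j _]] := free_index (Some i) None.
  have := in_p (corner j); rewrite !inE (inj_eq corner_inj) (eq_sym (corner j)).
  by rewrite corner_neq // orbF => /eqP E; rewrite E eqxx in i'j.
rewrite rcons_cons [path _ _ _]/=.
case: (vertexP z) => [j|y y'v] /andP[]; last first.
  (* Leaving at once would mean going to [n i], which is already the last vertex. *)
  rewrite adj_corner_outer // => /eqP -> _ /=.
  by rewrite mem_rcons mem_head /= andbF.
rewrite adj_corner => neq_ij path_d Ud in_d.
have [k U3] := third_index neq_ij.
(* Once the three corners are moved to the front, uniqueness leaves none in the rest [s]. *)
have out_d s :
  perm_eq (corner i :: corner j :: rcons d (inl (n i)))
          (map corner [:: i; j; k] ++ s) ->
  uniq s /\ forall l, corner l \notin s.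
  move/perm_uniq=> Es; have := Ud : is_true (uniq (corner i :: corner j :: rcons d (inl (n i)))).
  rewrite Es cat_uniq => /and3P[_ /hasPn out_s Us]; split=> // l.
  apply: contraL (map_f corner (mem_uniq3 l U3)); exact: out_s.
have [k'i k'j] : k != i /\ k != j.
  by move: U3; rewrite /= !inE negb_or ![_ == k]eq_sym => /and3P[/andP[]].
have mem_k s : corner k \in [:: corner i, corner j & rcons s (inl (n i))] -> corner k \in s.
  rewrite !inE mem_rcons inE !(inj_eq corner_inj) (negPf k'i) (negPf k'j).
  by rewrite eq_sym corner_neq.
case: d => [|w d] in path_d Ud in_d out_d; first by have := mem_k _ (in_d (corner k)).
move: path_d; rewrite rcons_cons [path _ _ _]/=.
case: (vertexP w) => [l|y y'v] in Ud in_d out_d * => /andP[].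
  rewrite adj_corner => neq_jl path_d.
  have El : l = k.
    have i'l : l != i by apply: contraTneq Ud => ->; rewrite /= !inE eqxx !orbT.
    by have := mem_uniq3 l U3; rewrite !inE (negPf i'l) eq_sym (negPf neq_jl) => /eqP.
  rewrite {}El in Ud in_d out_d path_d *.
  have [Us out_s] := out_d _ (perm_refl _).
  have outerE q : q \in rcons d (inl (n i)) -> exists2 y, y != v & q = inl y.
    by case: (vertexP q) => [m|y y'v _]; [rewrite (negPf (out_s m)) | exists y].
  exists (v :: [seq (port q).1 | q <- rcons d (inl (n i))]); split.
  (* The length is at least three: otherwise [corner k] would be adjacent to [inl (n i)], against
     [k != i]. *)
  - case: d path_d {Ud in_d out_d Us out_s outerE} => [|q d _] /=.
      by rewrite adj_corner_outer // (inj_eq n_inj) eq_sym (negPf k'i).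
    by rewrite size_map size_rcons.
  - rewrite /ucycle /= rcons_path map_rcons last_rcons adj_sym adj_n -map_rcons.
    have := path_outer out_s path_d; rewrite port_corner => -> /=.
    rewrite map_inj_in_uniq ?Us ?andbT; last first.
      by move=> p1 p2 /outerE[y1 _ ->] /outerE[y2 _ ->] /= ->.
    by apply/mapP=> -[q /outerE[y y'v ->] /= Ey]; rewrite Ey eqxx in y'v.
  move=> y; rewrite inE; have [//|y'v] := eqVneq y v.
  have := in_d (inl y); rewrite rcons_cons !inE !corner_neq //= => d_x.
  exact: (map_f (fun q => (port q).1) d_x).
(* The cycle leaves at [corner j], so [corner k] lies between two outer vertices; both equal [n k],
   against uniqueness. *)
rewrite adj_corner_outer // => /eqP Ey; rewrite {}Ey in y'v Ud in_d out_d * => path_d.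
have d_k : corner k \in d.
  by have := mem_k _ (in_d (corner k)); rewrite inE eq_sym corner_neq.
case/splitPr: d / d_k => d1 d2 in Ud in_d out_d path_d *.
have [|Us out_s] := out_d ((inl (n j) :: d1) ++ rcons d2 (inl (n i))).
  rewrite /= !perm_cons rcons_cat rcons_cons.
  exact/permPl/(perm_catCA (inl (n j) :: d1) [:: corner k]).
have outerE q : q \in (inl (n j) :: d1) ++ rcons d2 (inl (n i)) ->
  triangle_adj (corner k) q -> q = inl (n k).
  case: (vertexP q) => [m|y2 y2'v _]; first by rewrite (negPf (out_s m)).
  by rewrite adj_corner_outer // => /eqP->.
move: path_d; rewrite rcons_cat cat_path rcons_cons /= triangle_adj_sym.
case/and3P=> _ adj_l; case Ed2: (rcons d2 _) => [|q r] in Us outerE *.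
  by move/(congr1 size): Ed2; rewrite size_rcons.
case/andP=> adj_q _; have Eq : q = inl (n k).
  by apply: outerE adj_q; rewrite mem_cat mem_head orbT.
have El : last (inl (n j)) d1 = inl (n k).
  by apply: outerE adj_l; rewrite mem_cat mem_last.
move: Us; rewrite cat_uniq => /and3P[_ /hasPn/(_ q)]; rewrite mem_head Eq -El.
by rewrite mem_last => /(_ isT).
Qed.

(** * Lifting spanning paths through the triangle *)

Lemma split_path (r : rel G) s :
  subrel r (@adj G) -> sorted r s -> uniq s -> v \in s ->
  exists s1 s2 a b, [/\ s = s1 ++ v :: s2, v \notin s1 ++ s2,
    olast s1 = omap n a /\ ohead s2 = omap n b, a = b -> a = None
    & (forall m, a = Some m -> r (n m) v) /\ (forall m, b = Some m -> r v (n m))].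
Proof.
move=> r_adj r_s Us s_v; case/splitPr: s / s_v => s1 s2 in r_s Us *.
have eq_s : perm_eq (s1 ++ v :: s2) (v :: s1 ++ s2) by exact/permPl/(perm_catCA s1 [:: v]).
have Us12 : uniq (v :: s1 ++ s2) by rewrite -(perm_uniq eq_s).
move: r_s; rewrite sorted_cat_olink => /and3P[_ r_v].
rewrite -cat1s sorted_cat_olink => /and3P[_ v_r _].
(* The vertex on either side of [v] is some [n m]; [None] records that [v] is an end of the path. *)
have lab o : (if o is Some x then adj v x else true) -> exists a, o = omap n a.
  case: o => [x|_]; last by exists None.
  by rewrite adj_v => /codomP[m ->]; exists (Some m).
have [|a Ea] := lab (olast s1).
  by move: r_v; case: (olast s1) => //= x /r_adj; rewrite adj_sym.
have [|b Eb] := lab (ohead s2).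
  by move: v_r; case: (ohead s2) => //= x /r_adj.
exists s1, s2, a, b; split=> //; first by case/andP: Us12.
  case: a Ea => // m Ea Eab; rewrite -Eab in Eb.
  have s1_m := olast_mem Ea; have s2_m := ohead_mem Eb.
  move: Us12; rewrite /= cat_uniq => /and4P[_ _ /hasPn/(_ _ s2_m)].
  by rewrite /= s1_m.
by split=> m Em; rewrite ?Em /= in Ea Eb; [move: r_v | move: v_r]; rewrite ?Ea ?Eb.
Qed.

Lemma sorted_split (T : eqType) (e : rel T) s1 x s2 :
  sorted e (s1 ++ x :: s2) =
    [&& sorted e s1, olink e (olast s1) (Some x), olink e (Some x) (ohead s2)
      & sorted e s2].
Proof. by rewrite sorted_cat_olink -(cat1s x s2) sorted_cat_olink /=. Qed.

(** A path uses at most two of the three edges at [v]. *)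
Lemma avoid_port (r : rel G) s :
  subrel r (@adj G) -> sorted r s -> uniq s -> v \in s ->
  exists m, sorted (avoid r (n m) v) s.
Proof.
move=> r_adj r_s Us s_v.
have [s1 [s2 [a [b [Es s'v [Ea Eb] _ _]]]]] := split_path r_adj r_s Us s_v.
have [m /andP[a'm b'm]] := free_index a b; exists m.
move: r_s; rewrite Es !sorted_split => /and4P[r_s1 r_v v_r r_s2].
have sub t : v \notin t -> sorted r t -> sorted (avoid r (n m) v) t.
  move=> t'v; apply: (@sub_in_sorted _ (predC1 v)) => [x y|].
    rewrite !inE => x'v y'v rxy; rewrite /avoid rxy !inE !xpair_eqE.
    by rewrite (negPf x'v) (negPf y'v) andbF.
  by apply/allP=> x t_x; apply: contraNneq t'v => <-.
move: s'v; rewrite mem_cat negb_or => /andP[s1'v s2'v].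
rewrite !sub // andbT /=; apply/andP; split.
  move: r_v; rewrite Ea; case: (a) a'm => //= i i'm r_i.
  rewrite /avoid r_i !inE !xpair_eqE (inj_eq n_inj) eqxx andbT.
  rewrite (negPf (n_neq i)) orbF; exact: i'm.
move: v_r; rewrite Eb; case: (b) b'm => //= i i'm r_i.
rewrite /avoid r_i !inE !xpair_eqE (inj_eq n_inj) eqxx /= eq_sym.
by rewrite (negPf (n_neq m)).
Qed.

(** In a path missing the edge from [n m] to [v], the vertex [v] is replaced by a walk from
    [corner i] to [corner k], whose indices differ from [m]. The relation [e] and the inner corners
    [w] stay open, so that one construction serves vertex and edge deletions. *)
Lemma expand_path (r : rel G) s m :
  subrel r (@adj G) -> sorted (avoid r (n m) v) s -> uniq s -> v \in s ->
  exists i k, uniq [:: i; m; k] /\ forall (e : rel (G + 'I_2)) w,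
    (forall x y, x != v -> y != v -> r x y -> e (inl x) (inl y)) ->
    e (inl (n i)) (corner i) -> e (corner k) (inl (n k)) ->
    path e (corner i) (map corner (rcons w k)) -> uniq (i :: rcons w k) ->
    exists t, [/\ sorted e t, uniq t,
      forall j, (corner j \in t) = (j \in i :: rcons w k)
      & forall x, x != v -> (inl x \in t) = (x \in s)].
Proof.
move=> r_adj r_s Us s_v.
have r'_adj : subrel (avoid r (n m) v) (@adj G) by move=> x y /andP[/r_adj].
have [s1 [s2 [a [b [Es s'v [Ea Eb] ab [rv vr]]]]]] := split_path r'_adj r_s Us s_v.
have a'm : a != Some m.
  by apply/eqP=> /rv; rewrite /avoid !inE eqxx andbF.
have b'm : b != Some m.
  by apply/eqP=> /vr; rewrite /avoid !inE eqxx orbT andbF.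
have [i [k [U3 a_i b_k]]] := end_indices a'm b'm ab; exists i, k; split=> // e w.
move=> e_r e_i e_k path_w Uw.
have eq_s : perm_eq s (v :: s1 ++ s2) by rewrite Es; exact/permPl/(perm_catCA s1 [:: v]).
have outer_s x : x \in s1 ++ s2 -> x != v by move=> s_x; apply: contraNneq s'v => <-.
have sub t : {subset t <= s1 ++ s2} -> sorted (avoid r (n m) v) t -> sorted e (map inl t).
  move=> t_s; rewrite sorted_map; apply: (@sub_in_sorted _ (predC1 v)) => [x y|].
    by rewrite !inE => x'v y'v /andP[rxy _]; apply: e_r.
  by apply/allP=> x /t_s/outer_s.
have corner_out j : corner j \notin map inl (s1 ++ s2).
  by apply/mapP=> -[x /outer_s x'v /eqP]; rewrite eq_sym corner_neq.
have inl_corner x u : x != v -> (inl x \in map corner u) = false.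
  by move=> x'v; apply/mapP=> -[j _ /eqP]; rewrite corner_neq.
have eq_t : perm_eq (map inl s1 ++ map corner (i :: rcons w k) ++ map inl s2)
                    (map corner (i :: rcons w k) ++ map inl (s1 ++ s2)).
  by rewrite map_cat perm_catCA.
exists (map inl s1 ++ map corner (i :: rcons w k) ++ map inl s2); split.
- move: r_s; rewrite Es sorted_split => /and4P[r_s1 _ _ r_s2].
  rewrite !sorted_cat_olink !sub //; last 2 first.
  + by move=> x s_x; rewrite mem_cat s_x orbT.
  + by move=> x s_x; rewrite mem_cat s_x.
  rewrite !olast_map ohead_map Ea Eb /= path_w andbT /olast -rcons_cons rev_rcons /=.
  apply/andP; split.
    by move: a_i; rewrite !inE => /orP[]/eqP-> //=.
  by move: b_k; rewrite !inE => /orP[]/eqP-> //=.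
- rewrite (perm_uniq eq_t) cat_uniq !map_inj_uniq ?Uw //; first last.
  + exact: corner_inj.
  + exact: inl_inj.
  rewrite andTb; apply/andP; split.
    by apply/hasPn=> _ /mapP[x /outer_s x'v ->]; apply/negbT/inl_corner.
  by move: Us; rewrite (perm_uniq eq_s) => /andP[].
- move=> j; rewrite (perm_mem eq_t) mem_cat (negPf (corner_out j)) orbF.
  by rewrite mem_map //; apply: corner_inj.
move=> x x'v; rewrite (perm_mem eq_t) mem_cat inl_corner // mem_map; last exact: inl_inj.
by rewrite (perm_mem eq_s) inE (negPf x'v).
Qed.

(** With [corner m] in the middle of the three corners, the path needs neither the edge from
    [corner m] to [n m] nor the triangle edge opposite to [corner m]. *)
Lemma traces_through_corners (r : rel G) (e : rel (G + 'I_2)) (A : pred G) m :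
  subrel r (@adj G) -> traces (avoid r (n m) v) A -> A v -> symmetric e ->
  (forall x y, x != v -> y != v -> r x y -> e (inl x) (inl y)) ->
  (forall i, i != m -> e (inl (n i)) (corner i)) ->
  (forall i, i != m -> e (corner i) (corner m)) ->
  traces e (fun p => A (port p).1).
Proof.
move=> r_adj [s [path_s Us in_s]] Av e_sym e_outer e_port e_corner.
have [|i [k [U3 H]]] := expand_path r_adj path_s Us; first by rewrite in_s.
have := U3; rewrite /= !inE negb_or eq_sym => /and3P[/andP[m'i _] k'm _].
rewrite eq_sym in m'i; rewrite eq_sym in k'm.
have [||||| t [path_t Ut cor_t out_t]] := H e [:: m].
- exact: e_outer.
- exact: e_port.
- by rewrite e_sym e_port.
- by rewrite /= e_corner // e_sym e_corner.
- exact: U3.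
exists t; split=> // p; case: (vertexP p) => [j|x x'v].
  by rewrite cor_t mem_uniq3 // -topredE /= port_corner.
by rewrite out_t // in_s.
Qed.

Lemma robust_triangle_graph : robust G -> robust triangle_graph.
Proof.
have id_adj : subrel (@adj G) (@adj G) by [].
have avoid_adj x y : subrel (avoid (@adj G) x y) (@adj G) by move=> ? ? /andP[].
have adj_n_v m : adj (n m) v by rewrite adj_sym adj_n.
have corner_neqr x i : x != v -> (corner i == inl x) = false.
  by move=> x'v; rewrite eq_sym corner_neq.
have avoid_tri_sym p q : symmetric (avoid triangle_adj p q).
  exact/avoid_sym/triangle_adj_sym.
case=> nhamG trace_del trace_avoid; split=> [|w|p q].
- exact: nonhamiltonian_triangle_graph.
- case: (vertexP w) => [m|x x'v].
    (* Deleting [corner m]: a path of [G] without the edge from [n m] to [v] needs only the other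
       two corners. *)
    have [s [path_s Us in_s]] := trace_avoid _ _ (adj_n_v m).
    have [i [k [U3 H]]] := expand_path id_adj path_s Us (in_s v).
    have := U3; rewrite /= !inE negb_or => /and3P[/andP[i'm i'k] m'k _].
    have [||||| t [path_t Ut cor_t out_t]] := H triangle_adj [::].
    + by move=> x y x'v y'v; rewrite adj_outer.
    + by rewrite adj_outer_corner ?n_neq.
    + by rewrite adj_corner_outer ?n_neq.
    + by rewrite /= adj_corner i'k.
    + by rewrite /= inE i'k.
    exists t; split=> // p; case: (vertexP p) => [j|x x'v].
      rewrite cor_t !inE (inj_eq corner_inj).
      have := mem_uniq3 j U3; rewrite !inE; have [->|_] := eqVneq j m.
        by rewrite eq_sym (negPf i'm) (negPf m'k).
      by rewrite orFb.
    by rewrite out_t // in_s !inE corner_neq.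
  have [s [path_s Us in_s]] := trace_del x.
  have s_v : v \in s by rewrite in_s inE eq_sym.
  (* The path of [G - x] leaves out some edge at [v], whose corner goes to the middle. *)
  have [m path_m] := avoid_port id_adj path_s Us s_v.
  have [||||||t [path_t Ut in_t]] := @traces_through_corners _ triangle_adj (predC1 x) m id_adj.
  + by exists s.
  + by rewrite /= eq_sym.
  + exact: triangle_adj_sym.
  + by move=> y z y'v z'v; rewrite adj_outer.
  + by move=> i _; rewrite adj_outer_corner ?n_neq.
  + by move=> i; rewrite adj_corner.
  exists t; split=> // p; rewrite in_t; case: (vertexP p) => [j|y y'v].
    by rewrite -!topredE /= port_corner corner_neqr // eq_sym x'v.
  by rewrite !inE.
(* The corner on the deleted edge goes to the middle. *)
have port_edge m : traces (avoid triangle_adj (inl (n m)) (corner m)) predT.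
  apply: (@traces_through_corners _ _ predT m id_adj) => //.
  + exact: trace_avoid.
  + move=> x y x'v y'v xy; rewrite /avoid adj_outer // xy !inE !xpair_eqE.
    by rewrite !corner_neq // andbF.
  + move=> i m'i; rewrite /avoid adj_outer_corner ?n_neq // eqxx !inE !xpair_eqE.
    by rewrite (inj_eq corner_inj) (negPf m'i) andbF corner_neq ?n_neq.
  move=> i m'i; rewrite /avoid adj_corner m'i !inE !xpair_eqE.
  by rewrite !corner_neqr ?n_neq ?andbF.
change (triangle_adj p q -> traces (avoid triangle_adj p q) predT).
case: (vertexP p) => [a|x x'v]; case: (vertexP q) => [b|y y'v].
- rewrite adj_corner => neq_ab; have [m] := third_index neq_ab.
  rewrite /= !inE negb_or => /and3P[/andP[_ a'm] b'm _].
  apply: (@traces_through_corners _ _ predT m id_adj) => //.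
  + exact: trace_avoid.
  + move=> x y x'v y'v xy; rewrite /avoid adj_outer // xy !inE !xpair_eqE.
    by rewrite !corner_neq.
  + move=> i _; rewrite /avoid adj_outer_corner ?n_neq // eqxx !inE !xpair_eqE.
    by rewrite !corner_neq ?n_neq.
  move=> i m'i; rewrite /avoid adj_corner m'i !inE !xpair_eqE !(inj_eq corner_inj).
  by rewrite !(eq_sym m) (negPf a'm) (negPf b'm) !andbF.
- rewrite adj_corner_outer // => /eqP ->.
  have [t [path_t Ut in_t]] := port_edge a; exists t; split=> //.
  by rewrite (eq_sorted (avoidC _ _ _)).
- by rewrite adj_outer_corner // => /eqP ->.
rewrite adj_outer // => /trace_avoid[s [path_s Us in_s]].
(* The deleted edge misses the triangle: a path of [G] avoiding it is lifted, again with a corner in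
   the middle whose edge at [v] is left out. *)
have [m path_m] := avoid_port (@avoid_adj x y) path_s Us (in_s v).
apply: (@traces_through_corners _ _ predT m (@avoid_adj x y)) => //.
+ by exists s.
+ by move=> z1 z2 z1'v z2'v; rewrite /avoid adj_outer.
+ move=> i _; rewrite /avoid adj_outer_corner ?n_neq // eqxx !inE !xpair_eqE.
  by rewrite !corner_neqr ?andbF.
move=> i m'i; rewrite /avoid adj_corner m'i !inE !xpair_eqE.
by rewrite !corner_neqr.
Qed.

End Triangle.

(** * Cubic platypuses of every even order from ten on *)

Lemma robust_platypus (G : sgraph) : 2 < #|G| -> robust G -> platypus G.
Proof.
move=> G_gt2 [nham trace_del _]; split=> // v.
exact/(traceable_deleteP v (ltnW G_gt2)).
Qed.

Lemma robust_petersen : robust petersen.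
Proof.
have [gt2 nham trace_del] := platypus_petersen; split=> // [w|A B _].
  exact/(traceable_deleteP w (ltnW gt2)).
exact: petersen_avoid.
Qed.

Lemma cubic_neighbors (G : sgraph) (v : G) : cubic G ->
  exists2 n : 'I_3 -> G, injective n & forall x, adj v x = (x \in codom n).
Proof.
move=> /(_ v); set N := [set y | adj v y] => card_N.
have sz i : i < 3 -> i < size (enum N) by rewrite -cardE card_N.
exists (fun i : 'I_3 => nth v (enum N) i) => [i j /eqP|x].
  by rewrite nth_uniq ?enum_uniq ?sz // => /eqP/val_inj.
have -> : adj v x = (x \in enum N) by rewrite mem_enum inE.
apply/(nthP v)/codomP => [[i lt_i <-]|[i ->]]; last by exists i; rewrite ?sz.
by rewrite -cardE card_N in lt_i; exists (Ordinal lt_i).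
Qed.

Lemma petersen_card : #|petersen| = 10.
Proof.
by have [s [Us sz_s in_s _]] := petersen_labelling; rewrite -(size_labelling Us in_s).
Qed.

Lemma robust_cubic_exists k : exists G : sgraph, [/\ cubic G, robust G & #|G| = 10 + k.*2].
Proof.
elim: k => [|k [G [cubG robG card_G]]].
  exists petersen; rewrite petersen_card; split=> //.
    exact: cubic_petersen.
  exact: robust_petersen.
have [v _] : exists v : G, v \in G by apply/card_gt0P; rewrite card_G.
have [n n_inj adj_v] := cubic_neighbors v cubG.
exists (triangle_graph v n); split.
- exact: cubic_triangle_graph.
- exact: robust_triangle_graph.
by rewrite card_triangle_graph card_G doubleS addn2 !addnS.
Qed.

Theorem theorem1 :
  (forall n : nat,
     (exists G : sgraph, [/\ cubic G, platypus G & #|G| = n])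
     <-> (~~ odd n /\ 10 <= n))
  /\ [/\ cubic petersen,
         platypus petersen
       & forall G : sgraph, cubic G -> platypus G ->
           #|petersen| <= #|G| /\
           (#|G| = #|petersen| -> isomorphic G petersen)].
Proof.
have ge10 (G : sgraph) : cubic G -> platypus G -> 10 <= #|G|.
  move=> cubG platG; case: (leqP #|G| 10) => [le10|/ltnW//].
  by have [->] := small_cubic_platypus cubG platG le10.
split=> [n|]; last split.
- split=> [[G [cubG platG <-]]|[even_n le10]].
    by split; [apply: cubic_order_even | apply: ge10].
  (* Each replacement adds two vertices to the ten of the Petersen graph, and [n - 10] is even. *)
  have [G [cubG robG card_G]] := robust_cubic_exists (n - 10)./2.
  have En : #|G| = n.
    rewrite card_G halfK oddB // (negPf even_n) subn0 subnKC //.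
  by exists G; split=> //; apply: robust_platypus; rewrite // En; apply: leq_trans le10.
- exact: cubic_petersen.
- exact: platypus_petersen.
move=> G cubG platG; rewrite petersen_card; split=> [|card_G]; first exact: ge10.
by have [] := small_cubic_platypus cubG platG; rewrite ?card_G.
Qed.
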